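(* Let $c>1$ and let $a_1\le a_2\le\cdots\le a_c\le a_{c+1}$ be positive integers, where the Boij–Söderberg decomposition of $\beta^c=\beta(a_1,\dots,a_c)$ has no instances of mass elimination. Then the New Algorithm (described in the context) decomposes $\beta^{c+1}=\beta(a_1,\dots,a_{c+1})$. In particular, the error diagram $$E=\beta^{c+1}-\sum_{s} y_s\,\pi(\mathbf e^s)$$ produced by the algorithm (the sum running over all steps of its three phases) is always the zero diagram.
   Context: Diagrams. A diagram is a finitely supported array $D=(D_{i,j})$ of rational numbers indexed by columns $i\ge 0$ and degrees $j\in\mathbb Z$. For positive integers $a_1\le\dots\le a_m$, $\beta(a_1,\dots,a_m)$ denotes the graded Betti diagram of $S/(f_1,\dots,f_m)$, where $f_1,\dots,f_m$ is a homogeneous regular sequence in a standard graded polynomial ring $S$ over a field with $\deg f_i=a_i$; explicitly $\beta(a_1,\dots,a_m)_{i,j}$ is the number of $i$-element subsets $T\subseteq\{1,\dots,m\}$ with $\sum_{t\in T}a_t=j$. Pure diagrams. A degree sequence is a strictly increasing sequence of integers $\mathbf d=(d_0,\dots,d_m)$; $\mathbf d\le\mathbf d'$ means $d_i\le d_i'$ for all $i$. $\pi(\mathbf d)$ is the diagram with $\pi(\mathbf d)_{i,d_i}=\prod_{k\ne i}\frac1{|d_i-d_k|}$ and all other entries $0$. Boij–Söderberg algorithm (Totally Ordered Decomposition Algorithm). Starting with $\beta=\beta(a_1,\dots,a_m)$, repeat: let $\mathbf d$ be the minimal degree sequence, $d_i=\min\{j:\beta_{i,j}\neq0\}$ for $0\le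 i\le m$; let $q>0$ be the maximal rational such that $\beta-q\pi(\mathbf d)$ has nonnegative entries; replace $\beta$ by $\beta-q\pi(\mathbf d)$; stop when $\beta=0$. This expresses $\beta(a_1,\dots,a_m)$ as $\sum_{s=1}^{\varepsilon}z_s\pi(\mathbf d^s)$ with $\mathbf d^1<\dots<\mathbf d^\varepsilon$ and $z_s>0$, and $\varepsilon$ is the number of steps. The elimination order is the sequence whose $k$-th entry is the set of positions $(i,j)$ whose entry first becomes $0$ at step $k$. Mass elimination occurs if for some $k<\varepsilon$ this set has more than one element. New Algorithm. Put $a=a_1+\dots+a_c$, $\beta^c=\beta(a_1,\dots,a_c)=\sum_{s=1}^{\varepsilon}z_s\pi(\mathbf d^s)$ (Boij–Söderberg decomposition), $\beta^{c+1}=\beta(a_1,\dots,a_{c+1})$, $N=2\varepsilon+c-1$. For $1\le s\le\varepsilon-1$ let $(i_s,j_s)$ be the unique position eliminated at step $s$ of the decomposition of $\beta^c$, and put $(i_\varepsilon,j_\varepsilon)=(c,a)$. The algorithm uses the following degree sequences $\mathbf e^s=(\mathbf e^s_0,\dots,\mathbf e^s_{c+1})$: Phase 1, $1\le s\le\varepsilon$: $\mathbf e^s$ is $\mathbf d^s$ with $a+a_{c+1}$ appended at the end. Phase 2, $s=\varepsilon+k$ with $1\le k\le c-1$: $\mathbf e^{\varepsilon+k}_i=\mathbf e^{\varepsilon+k-1}_i$ for $i\ne c-k+1$, and $\mathbf e^{\varepsilon+k}_{c-k+1}=a_1+\dots+a_{c-k}+a_{c+1}$. Phase 2 is skipped entirely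 if $a_c=a_{c+1}$. Phase 3, $\varepsilon+c\le s\le N$: $\mathbf e^s=(\mathbf e^{N+1-s})^\vee$, where $(\mathbf e^\vee)_k=\mathbf e_{c+1}-\mathbf e_{c+1-k}$ for $0\le k\le c+1$. Starting from $\beta^{c+1}$, run through the values of $s$ in increasing order, at step $s$ subtracting $y_s\pi(\mathbf e^s)$ from the current diagram, where $y_s\in\mathbb Q$ (of any sign) is chosen to make a designated entry zero. The designated entry is: in Phase 1, the entry in position $(i_s,j_s)$; in Phase 2, for $s=\varepsilon+k$, the top entry in column $c-k$, i.e. position $(c-k,\mathbf e^{\varepsilon+k}_{c-k})$; in Phase 3, the position given by reversing the elimination order of $\beta^c$, i.e. for $s<N$ the position $(i,\mathbf e^s_i)$ with $\mathbf e^s_i\neq\mathbf e^{s+1}_i$, and for $s=N$ the position $(0,0)$. The algorithm is said to decompose $\beta^{c+1}$ if the error diagram $E$ left at the end is the zero diagram.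
   Formalization: The formal theorem additionally assumes that every sequence e^s used by the algorithm is a degree sequence (strictly increasing); this can fail in Phase 2, e.g. a=(1,1,3,3;4) gives (0,3,6,6,9,12), for which π(e^s) is undefined. *)

(* Defs.v *)
From HB Require Import structures.
From mathcomp Require Import all_boot all_order all_algebra finmap monalg.

Set Implicit Arguments.
Unset Strict Implicit.
Unset Printing Implicit Defensive.

Import Order.TTheory GRing.Theory Num.Theory.

Local Open Scope ring_scope.

(* Finitely supported functions from positions (column, degree) to rat;
   [D@_(i, j)] is the entry of D in column i and degree j. *)
Definition diagram := {malg rat[(nat * int)%type]}.

Definition nonneg_entries (D : diagram) : Prop := forall p, 0 <= D@_p.

(* [psum a n] is a_1 + ... + a_n; degrees are indexed from 1 and the value
   [a 0] is never used. *)
Definition psum (a : nat -> nat) (n : nat) : int :=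
  (\sum_(1 <= t < n.+1) a t)%N%:Z.

(* The diagram beta(a_1, ..., a_m): one unit in position
   (#|T|, sum of the a_t for t in T) for each subset T of {1, ..., m},
   the ordinal t : 'I_m standing for the index t + 1. *)
Definition betti (m : nat) (a : nat -> nat) : diagram :=
  \sum_(T : {set 'I_m})
    << 1%:Q *g (#|T|, (\sum_(t in T) a t.+1)%N%:Z) >>.

Lemma betti_coef (m : nat) (a : nat -> nat) (i : nat) (j : int) :
  (betti m a)@_(i, j) =
  #|[set T : {set 'I_m} |
      (#|T| == i) && ((\sum_(t in T) a t.+1)%N%:Z == j)]|%:R.
Proof.
rewrite /betti raddf_sum -sum1_card natr_sum big_mkcond /=.
rewrite [RHS]big_mkcond /=; apply: eq_bigr => T _.
by rewrite mcoeffU inE xpair_eqE; case: ifP.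
Qed.

Definition degree_sequence (m : nat) (d : seq int) : bool :=
  (size d == m.+1) && sorted <%R d.

(* Meant for degree sequences only: if d has a repeated value, the
   corresponding factor is 0^-1 = 0. *)
Definition pure (d : seq int) : diagram :=
  \sum_(i < size d)
    << (\prod_(k < size d | k != i) `|d`_i - d`_k|%:~R^-1)
       *g (nat_of_ord i, d`_i) >>.

Lemma pure_coef (d : seq int) (i : nat) (j : int) :
  (pure d)@_(i, j) =
  if (i < size d)%N && (d`_i == j)
  then \prod_(k < size d | (k : nat) != i) `|d`_i - d`_k|%:~R^-1 else 0.
Proof.
rewrite /pure raddf_sum /=; under eq_bigr do rewrite mcoeffU xpair_eqE.
case: (ltnP i (size d)) => [lt_i|le_i] /=; last first.
  rewrite big1 // => k _; case: eqP => [eq_ki|_] //=.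
  by move: (ltn_ord k); rewrite eq_ki ltnNge le_i.
rewrite (bigD1 (Ordinal lt_i)) //= eqxx /= [X in _ + X]big1 => [|k]; last first.
  by rewrite -val_eqE /= => /negPf->.
by rewrite addr0; case: eqP.
Qed.

(* What is left of D after subtracting [y s *: pure (e s)] for all s in
   [steps]. *)
Definition residual (D : diagram) (e : nat -> seq int) (y : nat -> rat)
    (steps : seq nat) : diagram :=
  D - \sum_(s <- steps) y s *: pure (e s).

Definition is_min_degrees (m : nat) (D : diagram) (d : seq int) : Prop :=
  forall i, (i <= m)%N ->
    D@_(i, d`_i) != 0 /\ (forall j, D@_(i, j) != 0 -> d`_i <= j).

Definition bs_step (m : nat) (D : diagram) (d : seq int) (q : rat) : Prop :=
  [/\ degree_sequence m d,
      is_min_degrees m D d,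
      0 < q,
      nonneg_entries (D - q *: pure d)
    & forall q', nonneg_entries (D - q' *: pure d) -> q' <= q].

(* The steps s are numbered from 1 to [bs_len]. *)
Record decomposition := Decomposition {
  bs_len : nat;
  bs_seq : nat -> seq int;
  bs_coef : nat -> rat
}.

Definition bs_residual (D : diagram) (B : decomposition) (s : nat) : diagram :=
  residual D (bs_seq B) (bs_coef B) (iota 1 s).

(* B is the trace of a complete run of the algorithm on D.  The run cannot
   pass through 0 before its last step, by [is_min_degrees]. *)
Definition is_bs_decomposition (m : nat) (D : diagram) (B : decomposition) :
    Prop :=
  (forall s, (1 <= s <= bs_len B)%N ->
     bs_step m (bs_residual D B s.-1) (bs_seq B s) (bs_coef B s)) /\
  bs_residual D B (bs_len B) = 0.

(* The k-th term of the elimination order.  In a run of the algorithm the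
   entries never increase and stay nonnegative, so an entry that is zero
   after step k and not before becomes zero for the first time at step k. *)
Definition eliminated (D : diagram) (B : decomposition) (k : nat) :
    {fset (nat * int)%type} :=
  (msupp (bs_residual D B k.-1) `\` msupp (bs_residual D B k))%fset.

Definition mass_elimination (D : diagram) (B : decomposition) : Prop :=
  exists2 k, (1 <= k < bs_len B)%N & (1 < #|` eliminated D B k|)%N.

(* In the [na_] definitions (New Algorithm), B is the Boij-Soederberg
   decomposition of beta(a_1, ..., a_c). *)

Definition phase1_seq (c : nat) (a : nat -> nat) (B : decomposition) (s : nat) :
    seq int :=
  rcons (bs_seq B s) (psum a c.+1).

Fixpoint phase2_seq (c : nat) (a : nat -> nat) (B : decomposition) (k : nat) :
    seq int :=
  if k is k'.+1 then
    set_nth 0 (phase2_seq c a B k') (c - k + 1)%N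
      (psum a (c - k) + (a c.+1)%:Z)
  else phase1_seq c a B (bs_len B).

Definition dual_seq (e : seq int) : seq int :=
  [seq last 0 e - x | x <- rev e].

Definition na_last (c : nat) (B : decomposition) : nat :=
  (2 * bs_len B + c - 1)%N.

Definition na_seq (c : nat) (a : nat -> nat) (B : decomposition) (s : nat) :
    seq int :=
  if (s <= bs_len B)%N then phase1_seq c a B s
  else if (s < bs_len B + c)%N then phase2_seq c a B (s - bs_len B)
  else dual_seq (phase1_seq c a B (na_last c B + 1 - s)).

Definition na_steps (c : nat) (a : nat -> nat) (B : decomposition) : seq nat :=
  iota 1 (bs_len B)
  ++ (if a c == a c.+1 then [::] else iota (bs_len B + 1) (c - 1))
  ++ iota (bs_len B + c) (bs_len B).

(* [na_designated c a B s p]: p is the entry to be made zero at step s. *)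
Definition na_designated (c : nat) (a : nat -> nat) (B : decomposition)
    (s : nat) (p : nat * int) : Prop :=
  let e := na_seq c a B in
  if (s < bs_len B)%N then (p \in eliminated (betti c a) B s : Prop)
  else if s == bs_len B then p = (c, psum a c)
  else if (s < bs_len B + c)%N then
    let i := (c - (s - bs_len B))%N in p = (i, (e s)`_i)
  else if (s < na_last c B)%N then
    exists i, [/\ (i <= c.+1)%N, (e s)`_i != (e s.+1)`_i & p = (i, (e s)`_i)]
  else p = (0%N, 0).

Definition na_residual (c : nat) (a : nat -> nat) (B : decomposition)
    (y : nat -> rat) (s : nat) : diagram :=
  residual (betti c.+1 a) (na_seq c a B) y
    [seq r <- na_steps c a B | (r <= s)%N].

(* y lists coefficients chosen according to the New Algorithm. *)
Definition na_run (c : nat) (a : nat -> nat) (B : decomposition)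
    (y : nat -> rat) : Prop :=
  forall s, s \in na_steps c a B ->
  forall p, na_designated c a B s p -> (na_residual c a B y s)@_p = 0.

Definition na_error (c : nat) (a : nat -> nat) (B : decomposition)
    (y : nat -> rat) : diagram :=
  residual (betti c.+1 a) (na_seq c a B) y (na_steps c a B).

(* Main.v *)
(** An entry of the error diagram [E] is zero as soon as it is designated at the
    last step whose sequence passes through it.  Every position of [beta^(c+1)]
    lies on a sequence of Phase 1 or, after complementing the subset, on one of
    Phase 3, and the new positions of Phase 2 lie on sequences of Phase 3.  The
    last step through a position of Phase 3 is in Phase 3; for the other
    positions it is in Phase 1, or in Phase 2 for those of [d^eps].  So it
    does not matter that positions of Phases 1 and 3 may overlap and that the
    sequences need not increase from Phase 2 to Phase 3.  Only the [c+1] entries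
    of [e^N] in columns [1, ..., c+1] are not covered.  They are killed by the
    Herzog-Kuehl equations: for polynomials [f] of degree at most [c], the sum
    of [(-1)^i f(j) D_(i,j)] vanishes for [beta^(c+1)] and for pure diagrams,
    and one takes for [f] the product of [X - e^N_k] over all but one of these
    columns. *)
From HB Require Import structures.
Require Import Defs.
From mathcomp Require Import all_boot all_order all_algebra finmap monalg.
From mathcomp Require Import zify.

Set Implicit Arguments.
Unset Strict Implicit.

Import Order.TTheory GRing.Theory Num.Theory.

Local Open Scope ring_scope.

(** * Herzog-Kuehl equations *)

(** For [f = 'X^k] its vanishing is the k-th Herzog-Kuehl equation. A general [f] lets products of
    linear factors be plugged in directly. *)
Definition hk_pairing (f : {poly rat}) (D : diagram) : rat :=
  mmap idfun (fun p : nat * int => (-1) ^+ p.1 * f.[p.2%:~R]) D.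

HB.instance Definition _ (f : {poly rat}) :=
  GRing.Additive.copy (hk_pairing f)
    (mmap idfun (fun p : nat * int => (-1) ^+ p.1 * f.[p.2%:~R])).

Lemma hk_pairingU f c (i : nat) (j : int) :
  hk_pairing f << c *g (i, j) >> = c * ((-1) ^+ i * f.[j%:~R]).
Proof. exact: mmapU. Qed.

Lemma hk_pairingZ f c D : hk_pairing f (c *: D) = c * hk_pairing f D.
Proof.
rewrite /hk_pairing (mmapEw (msuppZ_le _ _)) mmapE big_distrr /=.
by apply: eq_bigr => k _; rewrite mcoeffZ -mulrA.
Qed.

Lemma hk_pairing_single f (D : diagram) (p : nat * int) :
  (forall q, D@_q != 0 -> q != p -> f.[q.2%:~R] = 0) ->
  hk_pairing f D = D@_p * ((-1) ^+ p.1 * f.[p.2%:~R]).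
Proof.
move=> f0; have le : (msupp D `<=` p |` msupp D)%fset by rewrite fsubsetUr.
rewrite /hk_pairing (mmapEw le) (big_fsetD1 p) ?fset1U1 //=.
rewrite big_seq big1 ?addr0 // => q.
rewrite !inE => /andP[qp]; rewrite (negPf qp) /= -mcoeff_neq0 => q0.
by rewrite f0 // !mulr0.
Qed.

(** With n the length of [s], the sum is the coefficient of X^(n-1) in the Lagrange interpolant of
    [f] at [s]. That interpolant is [f] itself, whose degree is below n-1. *)
Lemma lead_lagrange {F : fieldType} (s : seq F) (f : {poly F}) :
  uniq s -> (size f < size s)%N ->
  \sum_(i < size s) f.[s`_i] * \prod_(k < size s | k != i) (s`_i - s`_k)^-1 = 0.
Proof.
move=> us sf; pose n := size s.
pose L (i : 'I_n) := \prod_(k < n | k != i) ('X - (s`_k)%:P).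
pose w (i : 'I_n) := \prod_(k < n | k != i) (s`_i - s`_k)^-1.
have sL i : size (L i) = n.
  rewrite /L -big_filter size_prod_XsubC size_filter -sum1_count.
  rewrite sum1_card cardC1 card_ord.
  by rewrite prednK //; case: (n) i => [[]|].
have Lmon i : L i \is monic by apply: monic_prod => k _; apply: monicXsubC.
have Lii i : (L i).[s`_i] * w i = 1.
  rewrite /L /w horner_prod -big_split big1 //= => k ki.
  rewrite hornerXsubC mulfV // subr_eq0 nth_uniq //.
  by rewrite eq_sym -val_eqE in ki.
have Lij i j : i != j -> (L i).[s`_j] = 0.
  move=> ij; rewrite /L horner_prod (bigD1 j) 1?eq_sym //=.
  by rewrite hornerXsubC subrr mul0r.
pose g := \sum_(i < n) (f.[s`_i] * w i) *: L i - f.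
have g0 : g = 0.
  apply: (@roots_geq_poly_eq0 _ _ s) => //.
    apply/allP => x /(nthP 0) [j jn <-]; pose j' := Ordinal jn : 'I_n.
    rewrite /root /g hornerD hornerN horner_sum (bigD1 j') //= big1.
      by rewrite addr0 hornerZ -mulrA [w _ * _]mulrC Lii mulr1 subrr.
    by move=> i ij; rewrite hornerZ (Lij i j' ij) mulr0.
  apply: leq_trans (size_polyD _ _) _; rewrite geq_max size_polyN.
  rewrite (ltnW sf) andbT; apply: leq_trans (size_sum _ _ _) _.
  apply/bigmax_leqP => i _.
  by apply: leq_trans (size_scale_leq _ _) _; rewrite sL.
have := congr1 (fun q : {poly F} => q`_n.-1) g0.
rewrite /g coefB coef0 coef_sum [f`_ _]nth_default ?subr0; last first.
  by rewrite -ltnS (ltn_predK sf).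
move=> e; rewrite -[RHS]e; apply: eq_bigr => i _; rewrite coefZ.
by have := monicP (Lmon i); rewrite lead_coefE sL => ->; rewrite mulr1.
Qed.

Lemma prod_sign_ltn (n : nat) (i : 'I_n) (R : comPzRingType) :
  \prod_(k < n | k != i) (-1 : R) ^+ (k < i)%N = (-1) ^+ i.
Proof.
rewrite prodrXr; congr (_ ^+ _).
rewrite big_mkcond /= (eq_bigr (fun k : 'I_n => (k < i)%N : nat)); last first.
  by move=> k _; case: eqP => [->|//]; rewrite ltnn.
rewrite -big_mkcond /= sum1_card.
rewrite -[RHS](card_ord i) -(card_image (f := widen_ord (ltnW (ltn_ord i)))).
  apply: eq_card => k; apply/idP/imageP => [ki|[k' _ ->]]; last first.
    exact: (ltn_ord k').
  by exists (Ordinal ki) => //; apply: val_inj.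
by move=> x y /(congr1 val) /= xy; apply: val_inj.
Qed.

(** With n the length of [d], the absolute values in column i of [pure d] differ from the signed
    differences in the n-1-i factors with k > i. Together with (-1)^i this gives the sign (-1)^(n-1)
    in every column, so up to that sign the pairing is the sum of [lead_lagrange]. *)
Lemma hk_pairing_pure (f : {poly rat}) (d : seq int) :
  sorted <%R d -> (size f < size d)%N -> hk_pairing f (pure d) = 0.
Proof.
move=> sd sf; pose x := [seq j%:~R : rat | j <- d].
have sx : size x = size d by rewrite size_map.
have ux : uniq x by rewrite map_inj_uniq ?lt_sorted_uniq //; apply: intr_inj.
rewrite /pure raddf_sum /=.
have := lead_lagrange (s := x) (f := f) ux; rewrite sx.
move=> /(_ sf) /(congr1 ( *%R ((-1) ^+ (size d).-1))).
rewrite mulr0 => e; rewrite -[RHS]e mulr_sumr {e}; apply: eq_bigr => i _.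
rewrite hk_pairingU !(nth_map 0) // mulrA mulrC [RHS]mulrCA; congr (_ * _).
rewrite -(@prod_sign_ltn _ i).
have -> : (-1 : rat) ^+ (size d).-1 = \prod_(k < size d | k != i) -1.
  by rewrite prodr_const cardC1 card_ord.
rewrite -!big_split; apply: eq_bigr => k ki /=.
rewrite (nth_map 0) // -intrB; case: (ltngtP k i) => [lt|lt|/val_inj e].
- have dd : d`_k < d`_i by apply: (sorted_ltn_nth lt_trans 0 sd); rewrite ?inE.
  by rewrite gtr0_norm ?subr_gt0 // expr1 mulrC.
- have dd : d`_i < d`_k by apply: (sorted_ltn_nth lt_trans 0 sd); rewrite ?inE. 
  by rewrite ltr0_norm ?subr_lt0 // expr0 mulr1 mulN1r intrN invrN.
by rewrite e eqxx in ki.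
Qed.

Lemma size_finite_difference (R : idomainType) (f : {poly R}) (b : R) :
  (size (f - (f \Po ('X + b%:P)))%R <= (size f).-1)%N.
Proof.
have -> : f - (f \Po ('X + b%:P)) =
    \sum_(i < size f) f`_i *: ('X^i - ('X + b%:P) ^+ i).
  under eq_bigr do rewrite scalerBr.
  by rewrite sumrB -poly_def coefK comp_polyE.
apply: leq_trans (size_sum _ _ _) _; apply/bigmax_leqP => i _.
apply: leq_trans (size_scale_leq _ _) _.
(* X^i - (X+b)^i is the constant -b times a sum of products X^(i-1-j) (X+b)^j, so its degree is
   below i. *)
rewrite subrXX opprD addNKr -polyCN mul_polyC.
apply: leq_trans (size_scale_leq _ _) _.
apply: leq_trans (size_sum _ _ _) _; apply/bigmax_leqP => j _.
apply: leq_trans (size_polyMleq _ _) _.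
rewrite size_polyXn -[b]opprK polyCN size_exp_XsubC.
have := ltn_ord i; have := ltn_ord j; lia.
Qed.

(** Pairing each [T] without [x] with [x |: T] turns the sum for [f] into the sum over subsets of
    [A :\ x] for f(X) - f(X + b x), whose degree is smaller. After [#|A|] such differences nothing
    is left of [f]. *)
Lemma alternating_subset_sum (R : idomainType) (I : finType) (A : {set I})
    (b : I -> R) (f : {poly R}) :
  (size f <= #|A|)%N ->
  \sum_(T in powerset A) (-1) ^+ #|T| * f.[ \sum_(t in T) b t] = 0.
Proof.
move: f; move An: #|A| => n; elim: n A An => [|n IH] A An f sf.
  move: sf; rewrite leqn0 size_poly_eq0 => /eqP ->.
  by rewrite big1 // => T _; rewrite horner0 mulr0.
have [x xA] : exists x, x \in A by apply/set0Pn; rewrite -card_gt0 An.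
have D1 : #|A :\ x| = n by have := cardsD1 x A; rewrite xA An; lia.
rewrite (bigID (fun T : {set I} => x \in T)) /=.
rewrite (reindex_onto (fun T => x |: T) (fun T => T :\ x)) /=; last first.
  by move=> T /andP[_ xT]; apply: setD1K.
rewrite addrC (eq_bigl (mem (powerset (A :\ x)))); last first.
  by move=> T; rewrite /= !inE subsetD1.
rewrite [X in _ + X](eq_bigl (mem (powerset (A :\ x)))); last first.
  move=> T; rewrite /= !inE subsetD1 eqxx andbT subUset sub1set xA /=.
  case: (T \subset A) => //=; apply/eqP/idP => [<-|/setU1K //].
  by rewrite !inE eqxx.
rewrite -big_split /=.
rewrite -[RHS](IH (A :\ x) D1 (f - (f \Po ('X + (b x)%:P)))); last first.
  by apply: leq_trans (size_finite_difference _ _) _; lia.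
apply: eq_bigr => T; rewrite inE subsetD1 => /andP[_ xT].
rewrite cardsU1 xT exprS mulN1r mulNr -mulrBr; congr (_ * _).
rewrite hornerD hornerN horner_comp hornerD hornerX hornerC big_setU1 //=.
by rewrite addrC.
Qed.

Lemma hk_pairing_betti (f : {poly rat}) m a :
  (size f <= m)%N -> hk_pairing f (betti m a) = 0.
Proof.
move=> sf; rewrite /betti raddf_sum /=.
rewrite -[RHS](@alternating_subset_sum _ _ [set: 'I_m]
  (fun t => (a t.+1)%:R) f).
  rewrite powersetT; apply: eq_big => [T|T _]; first by rewrite inE.
  by rewrite hk_pairingU mul1r -pmulrn natr_sum.
by rewrite cardsT card_ord.
Qed.

(** * Positions on a degree sequence, and residuals *)

Definition on_seq (e : seq int) (p : nat * int) : bool :=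
  (p.1 < size e)%N && (e`_p.1 == p.2).

Lemma pure_off e p : ~~ on_seq e p -> (pure e)@_p = 0.
Proof. by case: p => i j; rewrite pure_coef /on_seq /= => /negPf ->. Qed.

Lemma pure_on e p : sorted <%R e -> on_seq e p -> 0 < (pure e)@_p.
Proof.
case: p => i j se; rewrite /on_seq pure_coef /= => ij; rewrite ij.
case/andP: ij => ie _; apply: prodr_gt0 => k ki.
rewrite invr_gt0 ltr0z normr_gt0 subr_eq0 nth_uniq ?lt_sorted_uniq //.
by rewrite eq_sym.
Qed.

Lemma residual_coef D e y l p :
  (residual D e y l)@_p = D@_p - \sum_(s <- l) y s * (pure (e s))@_p.
Proof.
rewrite /residual mcoeffB raddf_sum; congr (_ - _).
by apply: eq_bigr => s _; apply: mcoeffZ.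
Qed.

(** An entry is final after the last step whose sequence passes through its position, so a zero made
    at that step survives to the end. *)
Lemma residual_after D e y l p s :
  (forall r, r \in l -> (s < r)%N -> ~~ on_seq (e r) p) ->
  (residual D e y l)@_p = (residual D e y [seq r <- l | (r <= s)%N])@_p.
Proof.
move=> off; rewrite !residual_coef big_filter; congr (_ - _).
rewrite (bigID (fun r => r <= s)%N) /=.
rewrite [X in _ + X]big_seq_cond [X in _ + X]big1 ?addr0 // => r /andP[rl].
by rewrite -ltnNge => sr; rewrite pure_off ?mulr0 ?off.
Qed.

Lemma residual_untouched D e y l p :
  (forall r, r \in l -> ~~ on_seq (e r) p) -> (residual D e y l)@_p = D@_p.
Proof.
move=> off; rewrite residual_coef big_seq big1 ?subr0 // => r rl.
by rewrite pure_off ?mulr0 ?off.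
Qed.

Lemma residual_rcons D e y l s :
  residual D e y (rcons l s) = residual D e y l - y s *: pure (e s).
Proof. by rewrite /residual big_rcons opprD addrA. Qed.

(** The coefficient of a step is found by one division and does not enter the residuals of earlier
    steps, so the coefficients can be chosen one after the other. *)
Lemma sequential_elimination D e (l : seq nat) (P : nat -> nat * int -> Prop) :
  sorted ltn l ->
  (forall s, s \in l ->
     exists2 p0, (pure (e s))@_p0 != 0 & forall p, P s p -> p = p0) ->
  exists y, forall s, s \in l -> forall p, P s p ->
    (residual D e y [seq r <- l | (r <= s)%N])@_p = 0.
Proof.
elim/last_ind: l => [|l s IH] sl Pl; first by exists (fun=> 0).
have ls r : r \in l -> (r < s)%N.
  move: sl; rewrite -cats1 sorted_pairwise; last exact: ltn_trans.
  by rewrite pairwise_cat allrel1r => /and3P[/allP + _ _]; apply.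
have [|r rl|y yl] := IH.
- by move: sl; rewrite -cats1 => /cat_sorted2[].
- by apply: Pl; rewrite mem_rcons inE rl orbT.
have [|p0 p0s Ps] := Pl s; first by rewrite mem_rcons inE eqxx.
pose z r := if r == s then (residual D e y l)@_p0 / (pure (e s))@_p0 else y r.
have ez l' : {subset l' <= l} -> residual D e z l' = residual D e y l'.
  move=> l'l; congr (_ - _); apply: eq_big_seq => r /l'l /ls rs.
  by rewrite /z ltn_eqF.
exists z => r; rewrite mem_rcons inE; have [-> _|rs /= rl] := eqVneq r s.
  move=> p /Ps -> {p}; rewrite (_ : filter _ _ = rcons l s); last first.
    apply/all_filterP/allP => t; rewrite mem_rcons inE => /predU1P[-> //|/ls].
    exact: ltnW.
  rewrite residual_rcons ez // mcoeffB mcoeffZ /z eqxx divfK ?subrr //.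
move=> p /(yl r rl); rewrite filter_rcons leqNgt ls //= ez //.
by move=> t; rewrite mem_filter => /andP[].
Qed.

(** * Runs of the Boij-Soederberg algorithm *)

Section BoijSoederberg.
Variables (m : nat) (D : diagram) (B : decomposition).
Hypothesis hB : is_bs_decomposition m D B.
Implicit Types (s t i : nat).

Local Notation R := (bs_residual D B).
Local Notation d := (bs_seq B).

Lemma bs_stepP s :
  (0 < s <= bs_len B)%N -> bs_step m (R s.-1) (d s) (bs_coef B s).
Proof. exact: (proj1 hB). Qed.

Lemma bs_size s : (0 < s <= bs_len B)%N -> size (d s) = m.+1.
Proof. by case/bs_stepP => /andP[/eqP]. Qed.

Lemma bs_residualS s : (0 < s)%N -> R s = R s.-1 - bs_coef B s *: pure (d s).
Proof.
case: s => // s _; rewrite /bs_residual.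
have -> : iota 1 s.+1 = rcons (iota 1 s) s.+1.
  by rewrite -[in LHS](addn1 s) iotaD cats1.
exact: residual_rcons.
Qed.

(** A step only decreases entries and keeps them nonnegative, so an entry that has become zero stays
    zero. *)
Lemma bs_support_anti s t p :
  (s <= t <= bs_len B)%N -> (R t)@_p != 0 -> (R s)@_p != 0.
Proof.
elim: t => [|t IH]; first by rewrite leqn0 => /andP[/eqP ->].
have [-> //|st /andP[st1 tB]] := eqVneq s t.+1.
move=> Rt; apply: IH; first by lia.
apply: contraNneq Rt => Rt; have [_ _ q0 nn _] := @bs_stepP t.+1 tB.
have /bs_stepP[/andP[_ sd] _ _ _ _] : (0 < t.+1 <= bs_len B)%N by [].
rewrite eq_le; move: (nn p); rewrite -bs_residualS // => ->; rewrite andbT.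
rewrite bs_residualS //= mcoeffB Rt sub0r oppr_le0 mcoeffZ.
have [on|off] := boolP (on_seq (d t.+1) p); last by rewrite pure_off ?mulr0.
by apply/ltW/mulr_gt0 => //; apply: pure_on.
Qed.

Lemma bs_seq_support s i : (0 < s <= bs_len B)%N -> (i <= m)%N ->
  (R s.-1)@_(i, (d s)`_i) != 0.
Proof. by move=> /bs_stepP[_ dmin _ _ _] im; case: (dmin i im). Qed.

Lemma bs_seq_min s i j : (0 < s <= bs_len B)%N -> (i <= m)%N ->
  (R s.-1)@_(i, j) != 0 -> (d s)`_i <= j.
Proof. by move=> /bs_stepP[_ dmin _ _ _] im; case: (dmin i im) => _; apply. Qed.

Lemma bs_seq_support0 s i : (0 < s <= bs_len B)%N -> (i <= m)%N ->
  D@_(i, (d s)`_i) != 0.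
Proof.
move=> sB im; have R0 : R 0 = D by rewrite /bs_residual /residual big_nil subr0.
rewrite -R0; apply: (bs_support_anti (t := s.-1)); first by lia.
exact: bs_seq_support.
Qed.

(** The run ends at zero, so some step must touch each nonzero entry. *)
Lemma bs_support p : D@_p != 0 ->
  exists2 s, (0 < s <= bs_len B)%N & on_seq (d s) p.
Proof.
move=> Dp; have [/hasP[s]|/hasPn off] :=
    boolP (has (fun s => on_seq (d s) p) (iota 1 (bs_len B))).
  by rewrite mem_iota => sB on; exists s => //; lia.
have := congr1 (mcoeff p) (proj2 hB); rewrite mcoeff0 /bs_residual.
by rewrite residual_untouched // => e; rewrite e eqxx in Dp.
Qed.

(** Column minima can only grow while the support shrinks. *)
Lemma bs_seq_le s t i : (0 < s <= t)%N -> (t <= bs_len B)%N -> (i <= m)%N ->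
  (d s)`_i <= (d t)`_i.
Proof.
move=> st tB im; apply: bs_seq_min => //; first by lia.
by apply: bs_support_anti (bs_seq_support _ im); lia.
Qed.

(** Had the old minimum of column [i] survived step [s], it would bound the next minimum from above,
    and the minimum could not have moved. *)
Lemma bs_eliminated s i : (0 < s < bs_len B)%N -> (i <= m)%N ->
  (d s)`_i != (d s.+1)`_i -> (i, (d s)`_i) \in eliminated D B s.
Proof.
move=> sB im; have sB1 : (0 < s <= bs_len B)%N by lia.
rewrite /eliminated in_fsetD -!mcoeff_neq0 bs_seq_support // andbT.
have le : (d s)`_i <= (d s.+1)`_i by apply: bs_seq_le => //; lia.
apply: contra => Rs; rewrite eq_le le /=.
by apply: (bs_seq_min (s := s.+1)) => //; lia.
Qed.

Lemma bs_eliminated_on s p : (0 < s <= bs_len B)%N ->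
  p \in eliminated D B s -> on_seq (d s) p.
Proof.
move=> sB; rewrite /eliminated in_fsetD -!mcoeff_neq0 negbK => /andP[Rs Rs1].
apply: contraNT Rs1 => off; rewrite -(eqP Rs) (@bs_residualS s); last by lia.
by rewrite [X in _ == X]mcoeffB mcoeffZ pure_off // mulr0 subr0.
Qed.

Lemma bs_eliminated_uniq s p q : ~ mass_elimination D B ->
  (0 < s < bs_len B)%N -> p \in eliminated D B s -> q \in eliminated D B s ->
  p = q.
Proof.
move=> nomass sB ps qs; apply/eqP/negP => /negP pq; apply: nomass.
exists s => //.
rewrite (cardfsD1 p) ps (cardfsD1 q) in_fsetD1 qs andbT eq_sym pq; lia.
Qed.

End BoijSoederberg.

(** * Supports of the diagrams beta(a_1, ..., a_m) *)

(* Subsets of {1, ..., m} are encoded by predicates [b] on nat, [b t] saying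
   that t+1 belongs to the subset, so that m can vary. *)
Definition wsum (m : nat) (b : nat -> bool) (w : nat -> nat) : nat :=
  (\sum_(t < m) b t * w t)%N.

Lemma wsumS m b w : wsum m.+1 b w = (wsum m b w + b m * w m)%N.
Proof. by rewrite /wsum big_ord_recr. Qed.

Lemma eq_wsum m (b b' : nat -> bool) w :
  (forall t, (t < m)%N -> b t = b' t) -> wsum m b w = wsum m b' w.
Proof. by move=> bb'; apply: eq_bigr => t _; rewrite bb'. Qed.

Lemma wsumT1 m : wsum m xpredT (fun=> 1%N) = m.
Proof. by elim: m => [|m IH]; rewrite ?wsumS ?IH ?addn1 // /wsum big_ord0. Qed.

Lemma wsumC m b w : (wsum m b w + wsum m (predC b) w = wsum m xpredT w)%N.
Proof.
rewrite /wsum -big_split; apply: eq_bigr => t _ /=.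
by case: (b t); rewrite (mul1n, mul0n) ?mul0n ?mul1n ?addn0.
Qed.

Lemma wsum_init m k w : (k <= m)%N -> wsum m (ltn^~ k) w = wsum k xpredT w.
Proof.
move=> km; rewrite /wsum (big_ord_widen m (fun t => true * w t)%N) //.
by rewrite [in RHS]big_mkcond /=; apply: eq_bigr => t _; case: ifP.
Qed.

(** The subset trades [u] for [m]; weights are added on both sides because subtraction on [nat] is
    truncated. *)
Lemma wsum_swap m (b : nat -> bool) w u : (u < m)%N -> b u -> ~~ b m ->
  (wsum m.+1 (fun t => (t == m) || b t && (t != u)) w + w u
   = wsum m.+1 b w + w m)%N.
Proof.
move=> um bu bm; rewrite !wsumS eqxx (negPf bm) /= mul1n mul0n addn0.
rewrite addnAC; congr (_ + _)%N.
rewrite /wsum (bigD1 (Ordinal um)) //= [in RHS](bigD1 (Ordinal um)) //=.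
rewrite eqxx bu (ltn_eqF um) mul0n mul1n add0n addnC; congr (_ + _)%N.
apply: eq_bigr => t; rewrite -val_eqE /= => -> /=.
by rewrite (ltn_eqF (ltn_ord t)) andbT.
Qed.

Lemma psumE a n : psum a n = wsum n xpredT (a \o succn).
Proof.
rewrite /psum big_add1 /= big_mkord /wsum; congr Posz.
by apply: eq_bigr => t _; rewrite mul1n.
Qed.

Lemma psumS a n : psum a n.+1 = psum a n + (a n.+1)%:Z.
Proof. by rewrite !psumE wsumS mul1n PoszD. Qed.

Lemma betti_support m a (i : nat) (j : int) :
  (betti m a)@_(i, j) != 0 <->
  exists2 b, wsum m b (fun=> 1%N) = i & (wsum m b (a \o succn))%:Z = j.
Proof.
have sumE (T : {set 'I_m}) (b : pred nat) (w : nat -> nat) :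
    (forall t : 'I_m, b t = (t \in T)) -> (\sum_(t in T) w t)%N = wsum m b w.
  move=> bT; rewrite big_mkcond; apply: eq_bigr => t _.
  by rewrite bT; case: ifP; rewrite (mul1n, mul0n).
rewrite betti_coef pnatr_eq0 -lt0n; split.
  case/card_gt0P => T; rewrite inE => /andP[/eqP Ti /eqP Tj].
  pose b t := [exists u in T, val u == t].
  have bT (t : 'I_m) : b t = (t \in T).
    apply/existsP/idP => [[u /andP[uT /eqP/val_inj <-]] //|tT].
    by exists t; rewrite tT /=.
  exists b; first by rewrite -Ti -sum1_card (sumE _ _ (fun=> 1%N) bT).
  by rewrite -Tj (sumE _ _ (a \o succn) bT).
case=> b bi bj; pose T := [set t : 'I_m | b t].
have bT (t : 'I_m) : b t = (t \in T) by rewrite inE.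
apply/card_gt0P; exists T.
rewrite inE -bj (sumE _ _ (a \o succn) bT) eqxx andbT.
by rewrite -bi -sum1_card (sumE _ _ (fun=> 1%N) bT).
Qed.

Lemma betti_supportC m a (i : nat) (j : int) :
  (betti m a)@_(i, j) != 0 ->
  (i <= m)%N /\ (betti m a)@_((m - i)%N, psum a m - j) != 0.
Proof.
move=> /betti_support[b bi bj].
have ei := wsumC m b (fun=> 1%N); have ej := wsumC m b (a \o succn).
rewrite wsumT1 in ei; split; first by lia.
apply/betti_support; exists (predC b); first by lia.
by rewrite psumE; lia.
Qed.

(** A subset avoiding the index m+1 is counted by [betti m a]. Otherwise its complement avoids that
    index, which gives the dual position. *)
Lemma betti_support_rec m a (i : nat) (j : int) :
  (betti m.+1 a)@_(i, j) != 0 ->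
  (betti m a)@_(i, j) != 0 \/
  (i <= m.+1)%N /\ (betti m a)@_((m.+1 - i)%N, psum a m.+1 - j) != 0.
Proof.
move=> /betti_support[b]; rewrite !wsumS; case: (b m) => /= bi bj; last first.
  by left; apply/betti_support; exists b; lia.
right; have /betti_supportC [im] :
    (betti m a)@_(wsum m b (fun=> 1%N), (wsum m b (a \o succn))%:Z) != 0.
  by apply/betti_support; exists b.
rewrite psumS => h; split; first by lia.
rewrite (_ : m.+1 - i = m - wsum m b (fun=> 1))%N; last by lia.
by rewrite (_ : _ - j = psum a m - (wsum m b (a \o succn))%:Z) //; lia.
Qed.

Lemma betti_support_init m a k : (k <= m)%N ->
  (betti m a)@_(k, psum a k) != 0.
Proof.
move=> km; apply/betti_support; exists (ltn^~ k).
  by rewrite wsum_init // wsumT1.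
by rewrite wsum_init // psumE.
Qed.

(* For [a_(m+2) = a_(m+1)] the position in the conclusion is the dual, in
   [beta(a_1, ..., a_(m+2))], of the last position of column [i]: some subset
   attaining [j] contains the index m+1, which m+2 may then replace. *)
Lemma betti_support_top m a (i : nat) (j : int) :
  (forall t, (0 < t <= m.+1)%N -> (a t <= a m.+1)%N) -> (0 < i)%N ->
  (betti m.+1 a)@_(i, j) != 0 ->
  (forall j', (betti m.+1 a)@_(i, j') != 0 -> j' <= j) ->
  (betti m.+1 a)@_((m.+2 - i)%N, psum a m.+1 + (a m.+1)%:Z - j) != 0.
Proof.
move=> amax i0 ij jmax.
have [b bm [bi bj]] : exists2 b : nat -> bool, b m &
    wsum m.+1 b (fun=> 1%N) = i /\ (wsum m.+1 b (a \o succn))%:Z = j.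
  have [b bi bj] := (betti_support m.+1 a i j).1 ij.
  have [bm|bm] := boolP (b m); first by exists b.
  (* Trading an element [u] of the subset for [m] does not decrease the sum, and [j] is maximal, so
     the new subset attains [j] too. *)
  have [u um bu] : exists2 u, (u < m)%N & b u.
    have [/existsP[u bu]|/existsPn nb] := boolP [exists u : 'I_m, b u].
      by exists u.
    move: i0; rewrite -bi wsumS (negPf bm) /wsum big1 // => t _.
    by rewrite (negPf (nb t)).
  have bi' := wsum_swap (fun=> 1%N) um bu bm.
  have bj' := wsum_swap (a \o succn) um bu bm.
  move: bi' bj'; set b' := fun t => _; move=> bi' bj'.
  exists b'; first by rewrite /b' eqxx.
  split; first by lia.
  have am : (a u.+1 <= a m.+1)%N by apply: amax; lia.
  have le : (wsum m.+1 b' (a \o succn))%:Z <= j.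
    by apply: jmax; apply/betti_support; exists b' => //; lia.
  rewrite /= in bj'; apply: le_anti; rewrite le /= -bj lez_nat; lia.
apply/betti_support; exists (fun t => (t == m) || ~~ b t).
  have := wsumC m.+1 b (fun=> 1%N); rewrite wsumT1 bi !wsumS eqxx /= bm /=.
  rewrite (@eq_wsum m (fun t => (t == m) || ~~ b t) (predC b)); first by lia.
  by move=> t tm; rewrite (ltn_eqF tm).
have := wsumC m.+1 b (a \o succn); rewrite psumE; move: bj.
rewrite !wsumS eqxx /= bm /=.
rewrite (@eq_wsum m (fun t => (t == m) || ~~ b t) (predC b)); first by lia.
by move=> t tm; rewrite (ltn_eqF tm).
Qed.

Lemma wsum_eq0 m (b : nat -> bool) w :
  wsum m b (fun=> 1%N) = 0%N -> wsum m b w = 0%N.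
Proof.
elim: m => [|m IH]; first by rewrite /wsum !big_ord0.
by rewrite !wsumS; case: (b m) => h; [lia|rewrite IH ?mul0n //; lia].
Qed.

Lemma betti_column0 m a (j : int) : (betti m a)@_(0%N, j) != 0 -> j = 0.
Proof. by move=> /betti_support[b b0 <-]; rewrite wsum_eq0. Qed.

(** * Steps and degree sequences of the New Algorithm *)

Lemma size_dual_seq e : size (dual_seq e) = size e.
Proof. by rewrite size_map size_rev. Qed.

Lemma nth_dual_seq e i : (i < size e)%N ->
  (dual_seq e)`_i = last 0 e - e`_(size e - i.+1).
Proof. by move=> ie; rewrite (nth_map 0) ?size_rev // nth_rev. Qed.

Section NewAlgorithm.
Variables (c : nat) (a : nat -> nat) (B : decomposition).
Hypothesis hc : (1 < c)%N.
Hypothesis ha_mono : forall t, (1 <= t <= c)%N -> (a t <= a t.+1)%N.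
Hypothesis hB : is_bs_decomposition c (betti c a) B.
Hypothesis hB_mass : ~ mass_elimination (betti c a) B.
Hypothesis he : forall s, s \in na_steps c a B ->
  degree_sequence c.+1 (na_seq c a B s).

Local Notation L := (bs_len B).
Local Notation N := (na_last c B).
Local Notation d := (bs_seq B).
Local Notation e := (na_seq c a B).
Local Notation D := (psum a c.+1).
Local Notation steps := (na_steps c a B).

Lemma bs_len_gt0 : (0 < L)%N.
Proof.
have /(bs_support hB)[s + _] : (betti c a)@_(0%N, psum a 0) != 0.
  exact: betti_support_init.
by lia.
Qed.

Lemma na_lastE : N = (L + c + L).-1.
Proof. by rewrite /na_last; lia. Qed.

Lemma mem_na_steps s : (s \in steps) =
  [|| (0 < s <= L)%N, (a c != a c.+1) && (L < s < L + c)%N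
    | (L + c <= s <= N)%N].
Proof.
have := bs_len_gt0.
rewrite !mem_cat !mem_iota na_lastE; case: (a c == a c.+1) => L0.
  by rewrite in_nil; lia.
by rewrite mem_iota; lia.
Qed.

Lemma sorted_na_steps : sorted ltn steps.
Proof.
rewrite sorted_pairwise; last exact: ltn_trans.
have pw m n : pairwise ltn (iota m n).
  by rewrite -sorted_pairwise; [apply: iota_ltn_sorted|exact: ltn_trans].
rewrite /na_steps !pairwise_cat !pw /= andbT.
apply/andP; split.
  apply/allrelP => x y; rewrite mem_cat !mem_iota; case: ifP => _.
    by rewrite in_nil /=; lia.
  by rewrite mem_iota; lia.
case: ifP => _; first by rewrite allrel0l.
rewrite pw andbT; apply/allrelP => x y; rewrite !mem_iota; lia.
Qed.

Lemma na_seq1 s : (s <= L)%N -> e s = phase1_seq c a B s.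
Proof. by rewrite /na_seq => ->. Qed.

Lemma na_seq3 s :
  (L + c <= s)%N -> e s = dual_seq (phase1_seq c a B (N + 1 - s)).
Proof.
move=> Ls; rewrite /na_seq ifF; last by lia.
by rewrite ifF //; lia.
Qed.

Lemma size_phase1_seq s : (0 < s <= L)%N -> size (phase1_seq c a B s) = c.+2.
Proof. by move=> sL; rewrite size_rcons (bs_size hB). Qed.

Lemma nth_phase1_seq s i : (0 < s <= L)%N -> (i <= c)%N ->
  (phase1_seq c a B s)`_i = (d s)`_i.
Proof. by move=> sL ic; rewrite nth_rcons (bs_size hB) // ltnS ic. Qed.

Lemma nth_phase1_seq_last s : (0 < s <= L)%N -> (phase1_seq c a B s)`_c.+1 = D.
Proof. by move=> sL; rewrite nth_rcons (bs_size hB) // ltnn eqxx. Qed.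

Lemma nth_dual_phase1 s i : (0 < s <= L)%N -> (i <= c.+1)%N ->
  (dual_seq (phase1_seq c a B s))`_i = D - (phase1_seq c a B s)`_(c.+1 - i).
Proof.
by move=> sL ic; rewrite nth_dual_seq size_phase1_seq // last_rcons subSS.
Qed.

Lemma nth_phase2_seq k i : (k < c)%N ->
  (phase2_seq c a B k)`_i =
  if (c - k < i <= c)%N then psum a i.-1 + (a c.+1)%:Z
  else (phase1_seq c a B L)`_i.
Proof.
elim: k => [|k IH] kc /=; first by rewrite ifF //; lia.
rewrite nth_set_nth /=; case: eqP => [->|ik].
  by rewrite ifT ?addn1 //; lia.
rewrite IH; last exact: ltnW.
by congr (if _ then _ else _); lia.
Qed.

Lemma na_seq2 s i : (L < s < L + c)%N ->
  (e s)`_i = if (L + c - s < i <= c)%N then psum a i.-1 + (a c.+1)%:Z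
             else (phase1_seq c a B L)`_i.
Proof.
move=> sL; rewrite /na_seq ifF; last by lia.
rewrite ifT ?nth_phase2_seq; try lia.
by congr (if _ then _ else _); lia.
Qed.

(** * Positions met by Phases 1 and 3 *)

Definition in_phase1 (p : nat * int) : bool :=
  has (fun s => on_seq (phase1_seq c a B s) p) (iota 1 L).

Definition in_phase3 (p : nat * int) : bool :=
  has (fun s => on_seq (e s) p) (iota (L + c) L).

Lemma in_phase1P p :
  reflect (exists2 s, (0 < s <= L)%N & on_seq (phase1_seq c a B s) p)
          (in_phase1 p).
Proof.
apply: (iffP hasP) => -[s sL on]; exists s => //.
  by move: sL; rewrite mem_iota; lia.
by rewrite mem_iota; lia.
Qed.

Lemma in_phase3P p :
  reflect (exists2 s, (L + c <= s <= N)%N & on_seq (e s) p) (in_phase3 p).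
Proof.
have L0 := bs_len_gt0.
apply: (iffP hasP) => -[s sL on]; exists s => //.
  by move: sL; rewrite mem_iota na_lastE; lia.
by move: sL; rewrite mem_iota na_lastE; lia.
Qed.

(** Step N+1-s uses the dual of the sequence of step s, and duality sends (i, j) to (c+1-i, D-j). *)
Lemma in_phase1_dual (i : nat) (j : int) :
  (i <= c.+1)%N -> in_phase1 ((c.+1 - i)%N, D - j) -> in_phase3 (i, j).
Proof.
move=> ic /in_phase1P[s sL /andP[_ /= /eqP sj]]; apply/in_phase3P.
exists (N + 1 - s)%N.
  by rewrite na_lastE; lia.
rewrite /on_seq na_seq3 /=; last by rewrite na_lastE; lia.
rewrite (_ : N + 1 - (N + 1 - s) = s)%N; last by rewrite na_lastE; lia.
rewrite size_dual_seq size_phase1_seq // ltnS ic /= nth_dual_phase1 // sj.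
by rewrite subKr.
Qed.

Lemma betti_in_phase1 (p : nat * int) : (betti c a)@_p != 0 -> in_phase1 p.
Proof.
move=> /(bs_support hB)[s sL /andP[ps sp]]; apply/in_phase1P; exists s => //.
rewrite (bs_size hB) // in ps.
by rewrite /on_seq size_phase1_seq // nth_phase1_seq // sp andbT; lia.
Qed.

Lemma betti_in_phase3 (i : nat) (j : int) : (i <= c.+1)%N ->
  (betti c a)@_((c.+1 - i)%N, D - j) != 0 -> in_phase3 (i, j).
Proof. by move=> ic /betti_in_phase1; apply: in_phase1_dual. Qed.

(** The origin is dual to the entry appended to every Phase 1 sequence. *)
Lemma origin_in_phase3 : in_phase3 (0%N, 0).
Proof.
apply: in_phase1_dual => //; apply/in_phase1P.
exists L; first by rewrite bs_len_gt0 leqnn.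
rewrite /on_seq /= size_phase1_seq ?bs_len_gt0 ?leqnn //= subr0.
by rewrite nth_phase1_seq_last ?bs_len_gt0 ?leqnn.
Qed.

Lemma top_in_phase3 : in_phase3 (c.+1, D).
Proof.
apply: betti_in_phase3 => //; rewrite subnn subrr.
by have := betti_support_init a (leq0n c); rewrite psumE /wsum big_ord0.
Qed.

(** The position comes from the subset {1, ..., i-1, c+1}, whose complement {i, ..., c} gives a
    position of beta^c. *)
Lemma phase2_in_phase3 (i : nat) : (0 < i <= c)%N ->
  in_phase3 (i, psum a i.-1 + (a c.+1)%:Z).
Proof.
move=> ic; apply: betti_in_phase3; first by lia.
have /betti_supportC[] : (betti c a)@_(i.-1, psum a i.-1) != 0.
  by apply: betti_support_init; lia.
move=> _; rewrite psumS (_ : c.+1 - i = c - i.-1)%N; last by lia.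
by rewrite [psum a i.-1 + _]addrC addrKA.
Qed.

Lemma na_seq_last0 : (e N)`_0 = 0.
Proof.
have L0 := bs_len_gt0; rewrite na_seq3; last by rewrite na_lastE; lia.
rewrite nth_dual_phase1 ?subn0 //; last by rewrite na_lastE; lia.
by rewrite nth_phase1_seq_last ?subrr // na_lastE; lia.
Qed.

(** Column c of beta^c has a single position, the dual of (0, 0). Hence the designated entry of step
    eps lies on its sequence. *)
Lemma bs_seq_last_column : (d L)`_c = psum a c.
Proof.
have L0 := bs_len_gt0.
have /betti_supportC[_] : (betti c a)@_(c, (d L)`_c) != 0.
  by apply: (bs_seq_support0 hB); lia.
rewrite subnn => /betti_column0 /eqP; rewrite subr_eq0 => /eqP h.
by rewrite h.
Qed.

Lemma on_na_seq s (i : nat) (j : int) : s \in steps ->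
  on_seq (e s) (i, j) = (i <= c.+1)%N && ((e s)`_i == j).
Proof. by move=> /he /andP[/eqP ss _]; rewrite /on_seq ss. Qed.

Lemma on_phase1_seq s (i : nat) (j : int) : (0 < s <= L)%N ->
  on_seq (phase1_seq c a B s) (i, j) =
  (i <= c.+1)%N && ((phase1_seq c a B s)`_i == j).
Proof. by move=> sL; rewrite /on_seq size_phase1_seq. Qed.

(** Phase 2 replaces the columns c, ..., 2 one by one with positions of Phase 3, so a position
    outside Phase 3 sits in a column not yet replaced. For 0 < i < c, column [i] keeps its entry of
    d^eps up to step L+c-i, the very step that designates it. *)
Lemma on_phase2 s (i : nat) (j : int) : s \in steps -> (L < s < L + c)%N ->
  ~~ in_phase3 (i, j) -> on_seq (e s) (i, j) ->
  on_seq (phase1_seq c a B L) (i, j) /\ (i <= L + c - s \/ i = c.+1)%N.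
Proof.
move=> ss sL nP3; have L0 := bs_len_gt0.
rewrite on_na_seq // on_phase1_seq; last by lia.
move=> /andP[ic]; rewrite na_seq2 //; case: ifP => h /eqP ej.
  by case/negP: nP3; rewrite -ej; apply: phase2_in_phase3; lia.
by rewrite ic ej eqxx; split => //; lia.
Qed.

(** * Existence of a run *)

(** Each step must have at most one designated entry, and it must lie on [e s] so that one can
    divide by the entry of the pure diagram. Uniqueness comes from the absence of mass elimination
    in Phases 1 and 3; in Phase 2 and at the steps eps and N the position is explicit. *)
Lemma na_designated_uniq s : s \in steps ->
  exists2 p0, (pure (e s))@_p0 != 0 &
    forall p, na_designated c a B s p -> p = p0.
Proof.
move=> ss; have L0 := bs_len_gt0; have /andP[/eqP es sorted_es] := he ss.
have on0 i : (i <= c.+1)%N -> (pure (e s))@_(i, (e s)`_i) != 0.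
  by move=> ic; rewrite gt_eqF // pure_on // on_na_seq // ic eqxx.
rewrite /na_designated; case: (ltnP s L) => [sL|Ls].
  have s0 : (0 < s)%N by move: ss; rewrite mem_na_steps; lia.
  (* If nothing is designated, any position on [e s] serves as witness. *)
  have [->|[p0 p0s]] := fset_0Vmem (eliminated (betti c a) B s).
    by exists (0%N, (e s)`_0); [exact: on0|].
  exists p0; last first.
    by move=> p ps; apply: (bs_eliminated_uniq hB_mass (s := s)) => //; lia.
  have sL' : (0 < s <= L)%N by lia.
  case: p0 p0s => i j /(bs_eliminated_on sL') /andP[/= ic /eqP <-].
  rewrite (bs_size hB) // in ic.
  by rewrite -(nth_phase1_seq sL') // -na_seq1 ?on0 //; lia.
case: (eqVneq s L) => [sL|nsL].
  exists (c, psum a c) => //.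
  rewrite -bs_seq_last_column -(@nth_phase1_seq L) ?L0 ?leqnn //.
  by rewrite -na_seq1 // -{1}sL on0.
case: (ltnP s (L + c)) => sLc.
  exists ((c - (s - L))%N, (e s)`_(c - (s - L))) => //.
  by apply: on0; lia.
case: (ltnP s N) => sN; last first.
  exists (0%N, 0) => //.
  have sNe : s = N by move: ss; rewrite mem_na_steps; lia.
  by have := on0 0%N isT; rewrite [in (_, _)]sNe na_seq_last0.
have r0 : (0 < N - s < L)%N by move: sN; rewrite na_lastE; lia.
have rL : (N + 1 - s = (N - s).+1)%N by lia.
have rL1 : (N + 1 - s.+1 = N - s)%N by lia.
(* A change from e^s to e^(s+1) is dual to one between d^(N-s) and d^(N-s+1), hence to an
   elimination at step N-s. It cannot be dual to column c+1, where the degree is always [D]. *)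
have elim i : (i <= c.+1)%N -> (e s)`_i != (e s.+1)`_i ->
    (c.+1 - i <= c)%N /\
    ((c.+1 - i)%N, (d (N - s))`_(c.+1 - i))
      \in eliminated (betti c a) B (N - s).
  move=> ic; rewrite !na_seq3 ?rL ?rL1; try lia.
  rewrite !nth_dual_phase1 //; try lia.
  rewrite (inj_eq (addrI _)) eqr_opp.
  case: (leqP (c.+1 - i) c) => ic'.
    rewrite !nth_phase1_seq //; try lia.
    by rewrite eq_sym => h; split=> //; apply: (bs_eliminated hB).
  rewrite (_ : c.+1 - i = c.+1)%N; last by lia.
  by rewrite !nth_phase1_seq_last ?eqxx //; lia.
have [/existsP[i0 i0s]|/existsPn no] :=
    boolP [exists i : 'I_c.+2, (e s)`_i != (e s.+1)`_i].
  exists (nat_of_ord i0, (e s)`_i0); first by apply: on0; rewrite -ltnS.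
  move=> p [i [ic iss ->]].
  have [i0c el0] := elim i0 (ltn_ord i0) i0s; have [i1c el] := elim i ic iss.
  have [ii _] := bs_eliminated_uniq hB_mass r0 el el0.
  have <- // : i = i0 by have := ltn_ord i0; lia.
exists (0%N, (e s)`_0); first exact: on0.
move=> p [i [ic iss _]]; have := no (Ordinal (ic : (i < c.+2)%N)).
by rewrite iss.
Qed.

Lemma na_run_exists : exists y, na_run c a B y.
Proof.
apply: sequential_elimination sorted_na_steps _ => s.
exact: na_designated_uniq.
Qed.

(** * Vanishing of the error diagram *)

Variable y : nat -> rat.
Hypothesis hy : na_run c a B y.
Local Notation E := (na_error c a B y).

Lemma na_error_designated s p : s \in steps -> na_designated c a B s p ->
  (forall r, r \in steps -> (s < r)%N -> ~~ on_seq (e r) p) -> E@_p = 0.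
Proof.
by move=> ss sp off; rewrite /na_error (residual_after _ _ off); apply: hy sp.
Qed.

(** Take the last step of Phase 3 through the position. Before step N, the next sequence misses the
    position, so the entry is designated by the change. At step N only the origin is designated,
    which leaves the exceptional columns. *)
Lemma na_error_phase3 (i : nat) (j : int) : in_phase3 (i, j) ->
  (0 < i <= c.+1)%N && ((e N)`_i == j) \/ E@_(i, j) = 0.
Proof.
have L0 := bs_len_gt0.
case/in_phase3P=> s0 s0L s0p.
pose Q s := (L + c <= s <= N)%N && on_seq (e s) (i, j).
have Qs0 : exists s, Q s by exists s0; rewrite /Q s0L.
have QN s : Q s -> (s <= N)%N by case/andP => /andP[].
case: (ex_maxnP Qs0 QN) => s /andP[sL son] smax.
have st : s \in steps by rewrite mem_na_steps sL !orbT.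
move: (son); rewrite on_na_seq // => /andP[ic /eqP sj].
have off r : r \in steps -> (s < r)%N -> ~~ on_seq (e r) (i, j).
  move=> rst sr; apply/negP => ron; suff /smax : Q r by lia.
  by rewrite /Q ron andbT; move: rst; rewrite mem_na_steps; lia.
have des : na_designated c a B s (i, j) \/ s = N /\ (0 < i)%N.
  rewrite /na_designated ifF; last by lia.
  rewrite ifF; last by lia.
  rewrite ifF; last by lia.
  case: ifP => sN.
    left; exists i; split=> //; last by rewrite sj.
    have s1t : s.+1 \in steps by rewrite mem_na_steps; lia.
    have := off _ s1t (ltnSn s); rewrite on_na_seq // ic /= sj.
    by rewrite eq_sym.
  have sNe : s = N by lia.
  case: (posnP i) => i0; [left|by right].
  by rewrite -sj i0 sNe na_seq_last0.
case: des => [des|[sN i0]]; first by right; apply: na_error_designated des off.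
by left; rewrite i0 ic -sN sj eqxx.
Qed.

(** Take the last step [s] of Phase 1 through the position. If s < eps, the column minimum moves
    next, so the entry is designated at [s], and Phase 2 could meet it only through d^eps. The
    position lies on d^eps otherwise, and the column decides which later step, if any, is needed. *)
Lemma na_error_phase1 (i : nat) (j : int) :
  in_phase1 (i, j) -> ~~ in_phase3 (i, j) -> E@_(i, j) = 0.
Proof.
have L0 := bs_len_gt0.
case/in_phase1P=> s0 s0L s0p nP3.
pose Q s := (0 < s <= L)%N && on_seq (phase1_seq c a B s) (i, j).
have Qs0 : exists s, Q s by exists s0; rewrite /Q s0L.
have QL s : Q s -> (s <= L)%N by case/andP => /andP[].
case: (ex_maxnP Qs0 QL) => s /andP[sL son] smax.
have st : s \in steps by rewrite mem_na_steps sL.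
move: (son); rewrite on_phase1_seq // => /andP[ic /eqP sj].
have i_c : (i <= c)%N.
  rewrite -ltnS ltn_neqAle ic andbT; apply/eqP => ie; case/negP: nP3.
  by rewrite -sj ie nth_phase1_seq_last // ; apply: top_in_phase3.
rewrite nth_phase1_seq // in sj.
have off3 r : (L + c <= r <= N)%N -> ~~ on_seq (e r) (i, j).
  by move=> rL; apply: contra nP3 => ron; apply/in_phase3P; exists r.
have off1 r : (s < r <= L)%N -> ~~ on_seq (phase1_seq c a B r) (i, j).
  by move=> rL; apply/negP => ron; suff /smax : Q r; rewrite /Q ?ron; lia.
have [sltL|] := ltnP s L.
  apply: (na_error_designated st).
    rewrite /na_designated sltL -sj.
    apply: (bs_eliminated hB) => //; first by lia.
    have := off1 s.+1; rewrite on_phase1_seq; last by lia.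
    by rewrite ic nth_phase1_seq ?sj 1?eq_sym; try lia; apply; lia.
  move=> r; rewrite mem_na_steps => rst sr; have [rL|Lr] := leqP r L.
    by rewrite na_seq1 // off1 // sr.
  have [rLc|Lcr] := ltnP r (L + c); last by apply: off3; lia.
  apply/negP => /on_phase2[]; rewrite ?mem_na_steps //; first by lia.
  by rewrite (negPf (off1 L _)) // sltL leqnn.
move=> Ls; have {}Ls : s = L by lia.
rewrite {}Ls in st sL son smax sj off1.
have Dj : (betti c a)@_(i, j) != 0 by rewrite -sj; apply: (bs_seq_support0 hB).
have [ci|ic'] := eqVneq i c.
  apply: (na_error_designated st).
    by rewrite /na_designated ltnn eqxx -sj ci bs_seq_last_column.
  move=> r rst sr; have [rLc|Lcr] := ltnP r (L + c).
    by apply/negP => /on_phase2[] //; lia.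
  by apply: off3; move: rst; rewrite mem_na_steps; lia.
have [i0|i0] := posnP i.
  case/negP: nP3; move: Dj; rewrite i0 => /betti_column0 ->.
  exact: origin_in_phase3.
(* When Phase 2 is skipped, no step designates the position. But it is the last one of its column in
   beta^c, because the sequences increase and cover beta^c, so it belongs to Phase 3 after all. *)
have [acc|acc] := eqVneq (a c) (a c.+1).
  case/negP: nP3; apply: betti_in_phase3 => //.
  have amax t : (0 < t <= c)%N -> (a t <= a c)%N.
    have : forall n, (n <= c)%N -> (0 < c - n)%N -> (a (c - n)%N <= a c)%N.
      elim=> [|n IH] nc n0; first by rewrite subn0.
      apply: leq_trans (IH _ _); try lia.
      have := ha_mono (t := c - n.+1).
      rewrite (_ : (c - n.+1).+1 = c - n)%N; last by lia.
      by apply; lia.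
    by move=> h tc; have := h (c - t)%N; rewrite subKn; [apply|]; lia.
  have jmax j' : (betti c a)@_(i, j') != 0 -> j' <= j.
    move=> /(bs_support hB)[r rL /andP[_ /= /eqP <-]]; rewrite -sj.
    by apply: (bs_seq_le hB) => //; lia.
  rewrite psumS -acc; case: (c) hc amax Dj jmax => // c' _ amax Dj jmax.
  exact: betti_support_top.
(* This step of Phase 2 designates column [i], and the next one would be the first to replace it. *)
have st' : (L + (c - i))%N \in steps by rewrite mem_na_steps acc; lia.
apply: (na_error_designated st').
  rewrite /na_designated ifF; last by lia.
  rewrite ifF; last by lia.
  rewrite ifT; last by lia.
  rewrite (_ : c - (L + (c - i) - L) = i)%N; last by lia.
  rewrite na_seq2; last by lia.
  by rewrite ifF ?nth_phase1_seq ?sj //; lia.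
move=> r rst sr; have [rLc|Lcr] := ltnP r (L + c).
  by apply/negP => /on_phase2[] //; lia.
by apply: off3; move: rst; rewrite mem_na_steps; lia.
Qed.

Lemma na_error_untouched (i : nat) (j : int) :
  ~~ in_phase1 (i, j) -> ~~ in_phase3 (i, j) -> E@_(i, j) = 0.
Proof.
have L0 := bs_len_gt0; move=> nP1 nP3; rewrite /na_error residual_untouched.
  apply/eqP; apply: contraTT nP3 => /betti_support_rec[/betti_in_phase1|[ic]].
    by rewrite (negPf nP1).
  by rewrite negbK; apply: betti_in_phase3.
move=> r rst; apply/negP => ron.
have [rL|Lr] := leqP r L.
  case/negP: nP1; apply/in_phase1P; exists r; last by rewrite -na_seq1.
  by move: rst; rewrite mem_na_steps; lia.
have [rLc|Lcr] := ltnP r (L + c).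
  have Lrc : (L < r < L + c)%N by lia.
  have [on1 _] := on_phase2 rst Lrc nP3 ron.
  by case/negP: nP1; apply/in_phase1P; exists L; rewrite ?L0 ?leqnn.
case/negP: nP3; apply/in_phase3P; exists r => //.
by move: rst; rewrite mem_na_steps; lia.
Qed.

Lemma na_error_support (i : nat) (j : int) :
  E@_(i, j) != 0 -> (0 < i <= c.+1)%N && ((e N)`_i == j).
Proof.
apply: contraR => sup.
have [/na_error_phase3[|->]|nP3] := boolP (in_phase3 (i, j)).
- by rewrite (negPf sup).
- by [].
have [P1|nP1] := boolP (in_phase1 (i, j)).
  by rewrite na_error_phase1.
by rewrite na_error_untouched.
Qed.

Lemma hk_pairing_na_error (f : {poly rat}) :
  (size f <= c.+1)%N -> hk_pairing f E = 0.
Proof.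
move=> sf; rewrite /na_error /residual raddfB /= hk_pairing_betti //.
rewrite sub0r [hk_pairing f _]raddf_sum /=.
rewrite big_seq big1 ?oppr0 // => s /he/andP[/eqP es sorted_es].
by rewrite hk_pairingZ hk_pairing_pure ?mulr0 // es.
Qed.

Lemma na_error0 : E = 0.
Proof.
have L0 := bs_len_gt0.
have Nt : N \in steps by rewrite mem_na_steps na_lastE; lia.
have /andP[/eqP eN sorted_eN] := he Nt.
have uN := lt_sorted_uniq sorted_eN.
apply/malgP => -[i j]; rewrite mcoeff0; apply/eqP.
apply: contraT => Eij; have /andP[ic /eqP ej] := na_error_support Eij.
(* There are c factors, so [f] has the largest size that the Herzog-Kuehl equations allow here. *)
pose r := [seq (e N)`_k | k <- rem i (iota 1 c.+1)].
pose f := \prod_(x <- r) ('X - (x%:~R : rat)%:P).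
have ii : i \in iota 1 c.+1 by rewrite mem_iota; lia.
have sf : size f = c.+1.
  by rewrite /f size_prod_XsubC size_map size_rem // size_iota.
have := hk_pairing_na_error (eq_leq sf).
rewrite (hk_pairing_single (p := (i, j))).
  (* As the entry is nonzero, [j] would be a root of [f], that is, the degree of e^N in another
     column, against strict increase. *)
  move/eqP; rewrite !mulf_eq0 (negPf Eij) signr_eq0 /=.
  rewrite horner_prod prodf_seq_eq0.
  case/hasP => x /mapP[k kr ->] /=; rewrite hornerXsubC subr_eq0 eqr_int -ej.
  move: kr; rewrite mem_rem_uniq ?iota_uniq // inE mem_iota => /andP[ki kc].
  rewrite nth_uniq ?eN //; [|lia|lia].
  by rewrite eq_sym (negPf ki).
(* Both positions lie on e^N, so being different they are in different columns, and [j'] is a root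
   of [f]. *)
case=> i' j' /= /na_error_support/andP[ic' /eqP ej'] neq.
apply/eqP; rewrite horner_prod prodf_seq_eq0; apply/hasP; exists j'.
  rewrite -ej'; apply: map_f; rewrite mem_rem_uniq ?iota_uniq // inE mem_iota.
  apply/andP; split; last by lia.
  apply: contraNneq neq => ei.
  by rewrite -ej' -ej ei.
by rewrite /= hornerXsubC subrr.
Qed.

End NewAlgorithm.

Theorem theorem2p4 (c : nat) (a : nat -> nat) (B : decomposition)
    (hc : (1 < c)%N)
    (ha_pos : forall t, (1 <= t <= c.+1)%N -> (0 < a t)%N)
    (ha_mono : forall t, (1 <= t <= c)%N -> (a t <= a t.+1)%N)
    (hB : is_bs_decomposition c (betti c a) B)
    (hB_mass : ~ mass_elimination (betti c a) B)
    (he : forall s, s \in na_steps c a B ->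
            degree_sequence c.+1 (na_seq c a B s)) :
  (exists y, na_run c a B y) /\
  (forall y, na_run c a B y -> na_error c a B y = 0).
Proof.
by split; [apply: na_run_exists | move=> y; apply: na_error0].
Qed.
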